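(* Let $R$ be an integral domain containing $\mathbb{Z}$ as a subring. Let $G$ be the graph with vertex set $X=\{a,b_1,b_2,b_3,c,d,e\}$ and edges $\{a,b_i\}$ and $\{b_i,c\}$ for $i=1,2,3$, $\{b_1,b_2\}$, $\{b_1,b_3\}$, $\{b_2,b_3\}$, $\{c,d\}$, $\{c,e\}$. Let $\overline{G}$ be the graph with vertex set $\overline{X}=\{a,b,c,d,e\}$ and edges $\{a,b\}$, $\{b,c\}$, $\{c,d\}$, $\{c,e\}$. Then $\overline{G}$ is a tree, $G$ is not a tree, and the partially commutative metabelian Lie $R$-algebras $M(X;G)$ and $M(\overline{X};\overline{G})$ are universally equivalent.
   Context: For a finite undirected graph $G$ without loops and with vertex set $X$, the partially commutative metabelian Lie $R$-algebra $M(X;G)$ is the quotient of the free metabelian Lie $R$-algebra on the generating set $X$ by the ideal generated by all $[x,y]$ with $\{x,y\}$ an edge of $G$. (Metabelian: $[[a,b],[c,d]]=0$ for all $a,b,c,d$.) Two Lie algebras are universally equivalent if they satisfy the same universal sentences, i.e. sentences without free variables of the form $\forall w_1\dots w_k\,\Phi(w_1,\dots,w_k)$ with $\Phi$ quantifier-free, in the first-order language with equality, addition $+$, Lie bracket $[\cdot,\cdot]$ and $0$ (equivalently, if they satisfy the same existential sentences). *)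

(* Defs.v *)
From HB Require Import structures.
From mathcomp Require Import all_boot all_order all_algebra.
From mathcomp Require Import boolp classical_sets.

Set Implicit Arguments.
Unset Strict Implicit.
Unset Printing Implicit Defensive.

Import GRing.Theory.
Local Open Scope ring_scope.
Local Open Scope quotient_scope.

Record sgraph := SGraph {
  vertex :> finType;
  edge : rel vertex;
  edge_sym : symmetric edge;
  edge_irrefl : irreflexive edge }.

(* The length bound excludes the degenerate closed walks x, y, x. *)
Definition has_cycle (G : sgraph) : Prop :=
  exists p : seq G, [/\ (2 < size p)%N, uniq p & cycle (@edge G) p].

Definition is_tree (G : sgraph) : Prop :=
  [/\ (0 < #|G|)%N, (forall x y : G, connect (@edge G) x y) & ~ has_cycle G].

Section GraphOfEdges.
Variables (T : finType) (E : seq (T * T)).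
Hypothesis E_loopless : all (fun uv => uv.1 != uv.2) E.

Definition edge_of : rel T := fun x y => ((x, y) \in E) || ((y, x) \in E).

Lemma edge_of_sym : symmetric edge_of.
Proof. by move=> x y; rewrite /edge_of orbC. Qed.

Lemma edge_of_irrefl : irreflexive edge_of.
Proof.
move=> x; rewrite /edge_of orbb; apply/negP => /(allP E_loopless) /=.
by rewrite eqxx.
Qed.

Definition graph_of_edges := SGraph edge_of_sym edge_of_irrefl.
End GraphOfEdges.

HB.mixin Record Lmodule_hasLie (R : comNzRingType) L of GRing.Lmodule R L := {
  lie : L -> L -> L;
  lieDl : forall x y z : L, lie (x + y) z = lie x z + lie y z;
  lieDr : forall x y z : L, lie x (y + z) = lie x y + lie x z;
  lieZl : forall (r : R) (x y : L), lie (r *: x) y = r *: lie x y;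
  lieZr : forall (r : R) (x y : L), lie x (r *: y) = r *: lie x y;
  liexx : forall x : L, lie x x = 0;
  lie_jacobi : forall x y z : L,
    lie x (lie y z) + lie y (lie z x) + lie z (lie x y) = 0 }.

#[short(type="lieAlgType")]
HB.structure Definition LieAlgebra (R : comNzRingType) :=
  {L of GRing.Lmodule R L & Lmodule_hasLie R L}.

Definition metabelian (R : comNzRingType) (L : lieAlgType R) : Prop :=
  forall a b c d : L, lie (lie a b) (lie c d) = 0.

Definition lie_hom (R : comNzRingType) (L L' : lieAlgType R) (f : L -> L') :=
  [/\ forall x y, f (x + y) = f x + f y,
      forall (r : R) x, f (r *: x) = r *: f x &
      forall x y, f (lie x y) = lie (f x) (f y)].

Section LieTheory.
Variables (R : comNzRingType) (L : lieAlgType R).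
Implicit Types x y z : L.

Lemma lieC x y : lie x y = - lie y x.
Proof.
apply/eqP; rewrite -addr_eq0; have := liexx (x + y).
by rewrite lieDl !lieDr !liexx add0r addr0 => ->.
Qed.

Lemma lieNl x y : lie (- x) y = - lie x y.
Proof. by rewrite -scaleN1r lieZl scaleN1r. Qed.

Lemma lieNr x y : lie x (- y) = - lie x y.
Proof. by rewrite -scaleN1r lieZr scaleN1r. Qed.

(* By anticommutativity, closure under brackets on one side suffices. *)
Definition lie_ideal (I : set L) : Prop :=
  [/\ I 0, forall x y, I x -> I y -> I (x + y),
      forall (r : R) x, I x -> I (r *: x) & forall x y, I y -> I (lie x y)].

Definition ideal_gen (S : set L) : set L :=
  fun x => forall I : set L, lie_ideal I -> (forall s, S s -> I s) -> I x.

Lemma ideal_gen_ideal S : lie_ideal (ideal_gen S).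
Proof.
split=> [I [I0 _ _ _] _ //|x y Sx Sy I idI SI|r x Sx I idI SI|x y Sy I idI SI].
- by have [_ ID _ _] := idI; apply: ID; [apply: Sx|apply: Sy].
- by have [_ _ IZ _] := idI; apply: IZ; apply: Sx.
- by have [_ _ _ IL] := idI; apply: IL; apply: Sy.
Qed.

Lemma sub_ideal_gen S s : S s -> ideal_gen S s.
Proof. by move=> Ss I _; apply. Qed.

End LieTheory.

Section LieQuotient.
Variables (R : comNzRingType) (L : lieAlgType R) (I : set L).
Hypothesis idI : lie_ideal I.

Definition quot_rel (x y : L) : bool := `[< I (x - y) >].

Lemma quot_rel_equiv : equiv_class_of quot_rel.
Proof.
have [I0 ID IZ _] := idI.
have IN x : I x -> I (- x) by rewrite -scaleN1r; apply: IZ.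
split=> [x|x y|y x z]; rewrite /quot_rel.
- by rewrite subrr; apply/asboolP.
- by apply/asbool_equiv_eq; split=> /IN; rewrite opprB.
- move=> /asboolP xy /asboolP yz; apply/asboolP.
  by rewrite -[x](addrNK y) -addrA; apply: ID.
Qed.

Definition quot_equiv := EquivRelPack quot_rel_equiv.
Definition lie_quot := {eq_quot quot_equiv}.
HB.instance Definition _ := EqQuotient.on lie_quot.
HB.instance Definition _ := Choice.on lie_quot.

Local Notation Q := lie_quot.

Lemma lie_quotW (P : Q -> Prop) : (forall x, P (\pi_Q x)) -> forall x, P x.
Proof. exact: quotW. Qed.

Lemma lie_quotP (x y : L) : \pi_Q x = \pi_Q y <-> I (x - y).
Proof.
split=> [/eqP|Ixy]; first by rewrite piE => /asboolP.
by apply/eqP; rewrite piE; apply/asboolP.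
Qed.

Lemma repr_lie_quot (x : L) : exists2 y, I y & repr (\pi_Q x) = x + y.
Proof.
exists (repr (\pi_Q x) - x); last by rewrite addrC subrK.
by apply/lie_quotP; rewrite reprK.
Qed.

Definition lq_zero : Q := \pi_Q 0.
Definition lq_opp (x : Q) : Q := \pi_Q (- repr x).
Definition lq_add (x y : Q) : Q := \pi_Q (repr x + repr y).
Definition lq_scale (r : R) (x : Q) : Q := \pi_Q (r *: repr x).
Definition lq_lie (x y : Q) : Q := \pi_Q (lie (repr x) (repr y)).

Lemma pi_lq_opp x : lq_opp (\pi_Q x) = \pi_Q (- x).
Proof.
have [_ _ IZ _] := idI; rewrite /lq_opp; have [y Iy ->] := repr_lie_quot x.
by apply/lie_quotP; rewrite opprD addrAC subrr add0r -scaleN1r; apply: IZ.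
Qed.

Lemma pi_lq_add x y : lq_add (\pi_Q x) (\pi_Q y) = \pi_Q (x + y).
Proof.
have [_ ID _ _] := idI; rewrite /lq_add.
have [x' Ix ->] := repr_lie_quot x; have [y' Iy ->] := repr_lie_quot y.
by apply/lie_quotP; rewrite addrACA [x + y + _]addrC addrK; apply: ID.
Qed.

Lemma pi_lq_scale r x : lq_scale r (\pi_Q x) = \pi_Q (r *: x).
Proof.
have [_ _ IZ _] := idI; rewrite /lq_scale; have [y Iy ->] := repr_lie_quot x.
by apply/lie_quotP; rewrite scalerDr addrAC subrr add0r; apply: IZ.
Qed.

Lemma pi_lq_lie x y : lq_lie (\pi_Q x) (\pi_Q y) = \pi_Q (lie x y).
Proof.
have [_ ID IZ IL] := idI; rewrite /lq_lie.
have [x' Ix ->] := repr_lie_quot x; have [y' Iy ->] := repr_lie_quot y.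
apply/lie_quotP; rewrite lieDr !(lieDl x x').
rewrite addrAC [lie x y + _]addrC addrK; apply: (ID).
  by rewrite lieC -scaleN1r; apply: IZ; apply: IL.
by apply: (ID); apply: IL.
Qed.

Let piE' := (pi_lq_opp, pi_lq_add, pi_lq_scale, pi_lq_lie).

Lemma lq_addA : associative lq_add.
Proof.
move=> x y z.
elim/lie_quotW: x => x; elim/lie_quotW: y => y; elim/lie_quotW: z => z.
by rewrite !piE' addrA.
Qed.
Lemma lq_addC : commutative lq_add.
Proof.
move=> x y; elim/lie_quotW: x => x; elim/lie_quotW: y => y.
by rewrite !piE' addrC.
Qed.
Lemma lq_add0 : left_id lq_zero lq_add.
Proof. by move=> x; elim/lie_quotW: x => x; rewrite !piE' add0r. Qed.
Lemma lq_addN : left_inverse lq_zero lq_opp lq_add.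
Proof. by move=> x; elim/lie_quotW: x => x; rewrite !piE' addNr. Qed.
HB.instance Definition _ :=
  GRing.isZmodule.Build Q lq_addA lq_addC lq_add0 lq_addN.

Lemma lq_scaleA a b (x : Q) : lq_scale a (lq_scale b x) = lq_scale (a * b) x.
Proof. by elim/lie_quotW: x => x; rewrite !piE' scalerA. Qed.
Lemma lq_scale1 : left_id 1 lq_scale.
Proof. by move=> x; elim/lie_quotW: x => x; rewrite !piE' scale1r. Qed.
Lemma lq_scaleDr : right_distributive lq_scale lq_add.
Proof.
move=> a x y; elim/lie_quotW: x => x; elim/lie_quotW: y => y.
by rewrite !piE' scalerDr.
Qed.
Lemma lq_scaleDl (x : Q) : {morph lq_scale^~ x : a b / a + b >-> lq_add a b}.
Proof. by move=> a b; elim/lie_quotW: x => x; rewrite !piE' scalerDl. Qed.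
HB.instance Definition _ :=
  GRing.Zmodule_isLmodule.Build R Q lq_scaleA lq_scale1 lq_scaleDr lq_scaleDl.

Lemma lq_lieDl x y z : lq_lie (lq_add x y) z = lq_add (lq_lie x z) (lq_lie y z).
Proof.
elim/lie_quotW: x => x; elim/lie_quotW: y => y; elim/lie_quotW: z => z.
by rewrite !piE' lieDl.
Qed.
Lemma lq_lieDr x y z : lq_lie x (lq_add y z) = lq_add (lq_lie x y) (lq_lie x z).
Proof.
elim/lie_quotW: x => x; elim/lie_quotW: y => y; elim/lie_quotW: z => z.
by rewrite !piE' lieDr.
Qed.
Lemma lq_lieZl r x y : lq_lie (lq_scale r x) y = lq_scale r (lq_lie x y).
Proof.
by elim/lie_quotW: x => x; elim/lie_quotW: y => y; rewrite !piE' lieZl.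
Qed.
Lemma lq_lieZr r x y : lq_lie x (lq_scale r y) = lq_scale r (lq_lie x y).
Proof.
by elim/lie_quotW: x => x; elim/lie_quotW: y => y; rewrite !piE' lieZr.
Qed.
Lemma lq_liexx x : lq_lie x x = lq_zero.
Proof. by elim/lie_quotW: x => x; rewrite !piE' liexx. Qed.
Lemma lq_jacobi x y z :
  lq_add (lq_add (lq_lie x (lq_lie y z)) (lq_lie y (lq_lie z x)))
         (lq_lie z (lq_lie x y)) = lq_zero.
Proof.
elim/lie_quotW: x => x; elim/lie_quotW: y => y; elim/lie_quotW: z => z.
by rewrite !piE' lie_jacobi.
Qed.
HB.instance Definition _ := Lmodule_hasLie.Build R Q
  lq_lieDl lq_lieDr lq_lieZl lq_lieZr lq_liexx lq_jacobi.

Definition lie_pi (x : L) : Q := \pi_Q x.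

Lemma lie_pi_hom : lie_hom lie_pi.
Proof.
split=> *; rewrite /lie_pi; symmetry;
  [exact: pi_lq_add | exact: pi_lq_scale | exact: pi_lq_lie].
Qed.

Lemma lie_pi_surj (q : Q) : exists x, lie_pi x = q.
Proof. by exists (repr q); rewrite /lie_pi reprK. Qed.

Lemma lie_piP (x : L) : lie_pi x = 0 <-> I x.
Proof. by rewrite -[x in I x]subr0; exact: lie_quotP. Qed.

End LieQuotient.

(* The formal expressions over [X], modulo the congruence generated by the
   identities of metabelian Lie [R]-algebras. *)
Section FreeMetabelian.
Variables (R : comNzRingType) (X : Type).

Inductive fm_expr : Type :=
| FmGen of X
| FmZero
| FmOpp of fm_expr
| FmAdd of fm_expr & fm_expr
| FmScale of R & fm_expr
| FmLie of fm_expr & fm_expr.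

Inductive fm_eq : fm_expr -> fm_expr -> Prop :=
| fm_refl x : fm_eq x x
| fm_sym x y : fm_eq x y -> fm_eq y x
| fm_trans y x z : fm_eq x y -> fm_eq y z -> fm_eq x z
| fm_congN x x' : fm_eq x x' -> fm_eq (FmOpp x) (FmOpp x')
| fm_congD x x' y y' :
    fm_eq x x' -> fm_eq y y' -> fm_eq (FmAdd x y) (FmAdd x' y')
| fm_congZ r x x' : fm_eq x x' -> fm_eq (FmScale r x) (FmScale r x')
| fm_congL x x' y y' :
    fm_eq x x' -> fm_eq y y' -> fm_eq (FmLie x y) (FmLie x' y')
| fm_addA x y z : fm_eq (FmAdd x (FmAdd y z)) (FmAdd (FmAdd x y) z)
| fm_addC x y : fm_eq (FmAdd x y) (FmAdd y x)
| fm_add0 x : fm_eq (FmAdd FmZero x) x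
| fm_addN x : fm_eq (FmAdd (FmOpp x) x) FmZero
| fm_scaleA r s x : fm_eq (FmScale r (FmScale s x)) (FmScale (r * s) x)
| fm_scale1 x : fm_eq (FmScale 1 x) x
| fm_scaleDr r x y :
    fm_eq (FmScale r (FmAdd x y)) (FmAdd (FmScale r x) (FmScale r y))
| fm_scaleDl r s x :
    fm_eq (FmScale (r + s) x) (FmAdd (FmScale r x) (FmScale s x))
| fm_lieDl x y z : fm_eq (FmLie (FmAdd x y) z) (FmAdd (FmLie x z) (FmLie y z))
| fm_lieDr x y z : fm_eq (FmLie x (FmAdd y z)) (FmAdd (FmLie x y) (FmLie x z))
| fm_lieZl r x y : fm_eq (FmLie (FmScale r x) y) (FmScale r (FmLie x y))
| fm_lieZr r x y : fm_eq (FmLie x (FmScale r y)) (FmScale r (FmLie x y))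
| fm_liexx x : fm_eq (FmLie x x) FmZero
| fm_jacobi x y z :
    fm_eq (FmAdd (FmAdd (FmLie x (FmLie y z)) (FmLie y (FmLie z x)))
                 (FmLie z (FmLie x y)))
          FmZero
| fm_metab x y z t : fm_eq (FmLie (FmLie x y) (FmLie z t)) FmZero.

HB.instance Definition _ := gen_eqMixin fm_expr.
HB.instance Definition _ := gen_choiceMixin fm_expr.

Definition fm_rel (x y : fm_expr) : bool := `[< fm_eq x y >].

Lemma fm_rel_equiv : equiv_class_of fm_rel.
Proof.
split=> [x|x y|y x z].
- by apply/asboolP; apply: fm_refl.
- by apply/asbool_equiv_eq; split; apply: fm_sym.
- move=> /asboolP xy /asboolP yz; apply/asboolP; exact: fm_trans xy yz.
Qed.

Definition fm_equiv := EquivRelPack fm_rel_equiv.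
Definition free_metab := {eq_quot fm_equiv}.
HB.instance Definition _ := EqQuotient.on free_metab.
HB.instance Definition _ := Choice.on free_metab.

Local Notation F := free_metab.

Lemma free_metabW (P : F -> Prop) : (forall x, P (\pi_F x)) -> forall x, P x.
Proof. exact: quotW. Qed.

Lemma free_metabP x y : \pi_F x = \pi_F y <-> fm_eq x y.
Proof.
split=> [/eqP|xy]; first by rewrite piE => /asboolP.
by apply/eqP; rewrite piE; apply/asboolP.
Qed.

Lemma fm_repr x : fm_eq (repr (\pi_F x)) x.
Proof. by apply/free_metabP; rewrite reprK. Qed.

Definition fq_zero : F := \pi_F FmZero.
Definition fq_opp (x : F) : F := \pi_F (FmOpp (repr x)).
Definition fq_add (x y : F) : F := \pi_F (FmAdd (repr x) (repr y)).
Definition fq_scale (r : R) (x : F) : F := \pi_F (FmScale r (repr x)).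
Definition fq_lie (x y : F) : F := \pi_F (FmLie (repr x) (repr y)).

Lemma pi_fq_opp x : fq_opp (\pi_F x) = \pi_F (FmOpp x).
Proof. by apply/free_metabP; apply: fm_congN; apply: fm_repr. Qed.
Lemma pi_fq_add x y : fq_add (\pi_F x) (\pi_F y) = \pi_F (FmAdd x y).
Proof. by apply/free_metabP; apply: fm_congD; apply: fm_repr. Qed.
Lemma pi_fq_scale r x : fq_scale r (\pi_F x) = \pi_F (FmScale r x).
Proof. by apply/free_metabP; apply: fm_congZ; apply: fm_repr. Qed.
Lemma pi_fq_lie x y : fq_lie (\pi_F x) (\pi_F y) = \pi_F (FmLie x y).
Proof. by apply/free_metabP; apply: fm_congL; apply: fm_repr. Qed.

Let piE' := (pi_fq_opp, pi_fq_add, pi_fq_scale, pi_fq_lie).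

Lemma fq_addA : associative fq_add.
Proof.
move=> x y z; elim/free_metabW: x => x; elim/free_metabW: y => y;
elim/free_metabW: z => z; rewrite !piE'.
by apply/free_metabP; apply: fm_addA.
Qed.
Lemma fq_addC : commutative fq_add.
Proof.
move=> x y; elim/free_metabW: x => x; elim/free_metabW: y => y; rewrite !piE'.
by apply/free_metabP; apply: fm_addC.
Qed.
Lemma fq_add0 : left_id fq_zero fq_add.
Proof.
by move=> x; elim/free_metabW: x => x; rewrite !piE'; apply/free_metabP/fm_add0.
Qed.
Lemma fq_addN : left_inverse fq_zero fq_opp fq_add.
Proof.
by move=> x; elim/free_metabW: x => x; rewrite !piE'; apply/free_metabP/fm_addN.
Qed.
HB.instance Definition _ :=
  GRing.isZmodule.Build F fq_addA fq_addC fq_add0 fq_addN.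

Lemma fq_scaleA a b (x : F) : fq_scale a (fq_scale b x) = fq_scale (a * b) x.
Proof.
by elim/free_metabW: x => x; rewrite !piE'; apply/free_metabP/fm_scaleA.
Qed.
Lemma fq_scale1 : left_id 1 fq_scale.
Proof.
by move=> x; elim/free_metabW: x => x; rewrite !piE';
apply/free_metabP/fm_scale1.
Qed.
Lemma fq_scaleDr : right_distributive fq_scale fq_add.
Proof.
move=> a; move=> x y; elim/free_metabW: x => x; elim/free_metabW: y => y.
by rewrite !piE'; apply/free_metabP/fm_scaleDr.
Qed.
Lemma fq_scaleDl (x : F) : {morph fq_scale^~ x : a b / a + b >-> fq_add a b}.
Proof.
by move=> a b; elim/free_metabW: x => x; rewrite !piE';
apply/free_metabP/fm_scaleDl.
Qed.
HB.instance Definition _ :=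
  GRing.Zmodule_isLmodule.Build R F fq_scaleA fq_scale1 fq_scaleDr fq_scaleDl.

Lemma fq_lieDl x y z : fq_lie (fq_add x y) z = fq_add (fq_lie x z) (fq_lie y z).
Proof.
elim/free_metabW: x => x; elim/free_metabW: y => y; elim/free_metabW: z => z.
by rewrite !piE'; apply/free_metabP/fm_lieDl.
Qed.
Lemma fq_lieDr x y z : fq_lie x (fq_add y z) = fq_add (fq_lie x y) (fq_lie x z).
Proof.
elim/free_metabW: x => x; elim/free_metabW: y => y; elim/free_metabW: z => z.
by rewrite !piE'; apply/free_metabP/fm_lieDr.
Qed.
Lemma fq_lieZl r x y : fq_lie (fq_scale r x) y = fq_scale r (fq_lie x y).
Proof.
elim/free_metabW: x => x; elim/free_metabW: y => y.
by rewrite !piE'; apply/free_metabP/fm_lieZl.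
Qed.
Lemma fq_lieZr r x y : fq_lie x (fq_scale r y) = fq_scale r (fq_lie x y).
Proof.
elim/free_metabW: x => x; elim/free_metabW: y => y.
by rewrite !piE'; apply/free_metabP/fm_lieZr.
Qed.
Lemma fq_liexx x : fq_lie x x = fq_zero.
Proof.
by elim/free_metabW: x => x; rewrite !piE'; apply/free_metabP/fm_liexx.
Qed.
Lemma fq_jacobi x y z :
  fq_add (fq_add (fq_lie x (fq_lie y z)) (fq_lie y (fq_lie z x)))
         (fq_lie z (fq_lie x y)) = fq_zero.
Proof.
elim/free_metabW: x => x; elim/free_metabW: y => y; elim/free_metabW: z => z.
by rewrite !piE'; apply/free_metabP/fm_jacobi.
Qed.
HB.instance Definition _ := Lmodule_hasLie.Build R F
  fq_lieDl fq_lieDr fq_lieZl fq_lieZr fq_liexx fq_jacobi.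

Definition fm_gen (x : X) : F := \pi_F (FmGen x).

Lemma free_metab_metabelian : metabelian (free_metab : lieAlgType R).
Proof.
move=> x y z t; elim/free_metabW: x => x; elim/free_metabW: y => y;
elim/free_metabW: z => z; elim/free_metabW: t => t.
change (fq_lie (fq_lie (\pi x) (\pi y)) (fq_lie (\pi z) (\pi t)) = fq_zero).
by rewrite !piE'; apply/free_metabP/fm_metab.
Qed.

Section UniversalProperty.
Variables (L : lieAlgType R) (g : X -> L).

Fixpoint fm_eval (t : fm_expr) : L :=
  match t with
  | FmGen x => g x
  | FmZero => 0
  | FmOpp t => - fm_eval t
  | FmAdd t u => fm_eval t + fm_eval u
  | FmScale r t => r *: fm_eval t
  | FmLie t u => lie (fm_eval t) (fm_eval u)
  end.

Lemma fm_eval_eq : metabelian L ->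
  forall t u, fm_eq t u -> fm_eval t = fm_eval u.
Proof.
move=> mL t u; elim=> //=; try by move=> *; congruence.
- by move=> *; rewrite addrA.
- by move=> *; rewrite addrC.
- by move=> *; rewrite add0r.
- by move=> *; rewrite addNr.
- by move=> *; rewrite scalerA.
- by move=> *; rewrite scale1r.
- by move=> *; rewrite scalerDr.
- by move=> *; rewrite scalerDl.
- by move=> *; rewrite lieDl.
- by move=> *; rewrite lieDr.
- by move=> *; rewrite lieZl.
- by move=> *; rewrite lieZr.
- by move=> *; rewrite liexx.
- by move=> *; rewrite lie_jacobi.
Qed.

Definition fm_lift (x : F) : L := fm_eval (repr x).

Lemma fm_lift_pi : metabelian L -> forall t, fm_lift (\pi_F t) = fm_eval t.
Proof. by move=> mL t; apply: fm_eval_eq (fm_repr t). Qed.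

Lemma fm_lift_hom : metabelian L -> lie_hom fm_lift.
Proof.
move=> mL; split=> [x y|r x|x y]; elim/free_metabW: x => x.
- elim/free_metabW: y => y.
  by rewrite [_ + _ in LHS]pi_fq_add !fm_lift_pi.
- by rewrite [_ *: _ in LHS]pi_fq_scale !fm_lift_pi.
- elim/free_metabW: y => y.
  by rewrite [lie _ _ in LHS]pi_fq_lie !fm_lift_pi.
Qed.

Lemma fm_lift_gen : metabelian L -> forall x, fm_lift (fm_gen x) = g x.
Proof. by move=> mL x; rewrite fm_lift_pi. Qed.

Lemma fm_lift_unique (f : F -> L) :
  metabelian L -> lie_hom f -> (forall x, f (fm_gen x) = g x) ->
  forall x, f x = fm_lift x.
Proof.
move=> mL [fD fZ fL] fg x; elim/free_metabW: x => t; rewrite fm_lift_pi //.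
have f0 : f 0 = 0 by rewrite -[X in f X](scale0r 0) fZ scale0r.
elim: t => //= [t IH|t IHt u IHu|r t IH|t IHt u IHu].
- by rewrite -pi_fq_opp -[fq_opp _]/(- \pi_F t) -scaleN1r fZ IH scaleN1r.
- by rewrite -pi_fq_add fD IHt IHu.
- by rewrite -pi_fq_scale fZ IH.
- by rewrite -pi_fq_lie fL IHt IHu.
Qed.

End UniversalProperty.
End FreeMetabelian.

Section PartiallyCommutative.
Variables (R : comNzRingType) (G : sgraph).

Definition pc_relators : set (free_metab R G) :=
  fun z => exists x y : G, edge x y /\ z = lie (fm_gen R x) (fm_gen R y).

Definition pc_metab : lieAlgType R :=
  lie_quot (ideal_gen_ideal pc_relators).

End PartiallyCommutative.

(* Terms and quantifier-free formulas in the variables w_0, ..., w_(k-1), over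
   the signature {+, [ , ], 0}: there is no symbol for scalar multiplication. *)
Inductive lie_term (k : nat) : Type :=
| TVar of 'I_k
| TZero
| TAdd of lie_term k & lie_term k
| TLie of lie_term k & lie_term k.

Inductive qf_formula (k : nat) : Type :=
| FEq of lie_term k & lie_term k
| FNot of qf_formula k
| FAnd of qf_formula k & qf_formula k
| FOr of qf_formula k & qf_formula k
| FImp of qf_formula k & qf_formula k.

Section Semantics.
Variables (R : comNzRingType) (L : lieAlgType R) (k : nat) (w : 'I_k -> L).

Fixpoint term_val (t : lie_term k) : L :=
  match t with
  | TVar i => w i
  | TZero => 0
  | TAdd t u => term_val t + term_val u
  | TLie t u => lie (term_val t) (term_val u)
  end.

Fixpoint sat (Phi : qf_formula k) : Prop :=
  match Phi with
  | FEq t u => term_val t = term_val u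
  | FNot P => ~ sat P
  | FAnd P Q => sat P /\ sat Q
  | FOr P Q => sat P \/ sat Q
  | FImp P Q => sat P -> sat Q
  end.
End Semantics.

Definition sat_forall (R : comNzRingType) (L : lieAlgType R) (k : nat)
  (Phi : qf_formula k) : Prop := forall w : 'I_k -> L, sat w Phi.

Definition universally_equivalent (R : comNzRingType) (L L' : lieAlgType R) :=
  forall (k : nat) (Phi : qf_formula k), sat_forall L Phi <-> sat_forall L' Phi.

Inductive vertexG := Ga | Gb1 | Gb2 | Gb3 | Gc | Gd | Ge.

Definition vertexG_enum := [:: Ga; Gb1; Gb2; Gb3; Gc; Gd; Ge].

Definition vertexG_idx (x : vertexG) : 'I_7 :=
  match x with
  | Ga => @Ordinal 7 0 isT | Gb1 => @Ordinal 7 1 isT | Gb2 => @Ordinal 7 2 isT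
  | Gb3 => @Ordinal 7 3 isT | Gc => @Ordinal 7 4 isT | Gd => @Ordinal 7 5 isT
  | Ge => @Ordinal 7 6 isT
  end.

Lemma vertexG_idxK : cancel vertexG_idx (fun i => nth Ga vertexG_enum i).
Proof. by case. Qed.

HB.instance Definition _ := Finite.copy vertexG (can_type vertexG_idxK).

Definition edgesG : seq (vertexG * vertexG) :=
  [:: (Ga, Gb1); (Ga, Gb2); (Ga, Gb3);
      (Gb1, Gc); (Gb2, Gc); (Gb3, Gc);
      (Gb1, Gb2); (Gb1, Gb3); (Gb2, Gb3);
      (Gc, Gd); (Gc, Ge)].

Definition graphG : sgraph := @graph_of_edges vertexG edgesG isT.

Inductive vertexGbar := Ha | Hb | Hc | Hd | He.

Definition vertexGbar_enum := [:: Ha; Hb; Hc; Hd; He].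

Definition vertexGbar_idx (x : vertexGbar) : 'I_5 :=
  match x with
  | Ha => @Ordinal 5 0 isT | Hb => @Ordinal 5 1 isT | Hc => @Ordinal 5 2 isT
  | Hd => @Ordinal 5 3 isT | He => @Ordinal 5 4 isT
  end.

Lemma vertexGbar_idxK :
  cancel vertexGbar_idx (fun i => nth Ha vertexGbar_enum i).
Proof. by case. Qed.

HB.instance Definition _ := Finite.copy vertexGbar (can_type vertexGbar_idxK).

Definition edgesGbar : seq (vertexGbar * vertexGbar) :=
  [:: (Ha, Hb); (Hb, Hc); (Hc, Hd); (Hc, He)].

Definition graphGbar : sgraph := @graph_of_edges vertexGbar edgesGbar isT.

(* Main.v *)
(** Collapsing the clique of twins [b1, b2, b3] does not change the universal
    theory. The target embeds in the source by choosing a representative of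
    each class of twins, so what has to be shown is that finitely many nonzero
    elements of [M(G)] survive some homomorphism [x |-> r_x f(x)] to [M(H)].
    Up to linear terms, the part of [M(G)] of a multidegree with support [S] is
    spanned by the differences [x - y] of vertices of [S], where adjacent
    vertices are identified; hence it is detected by the indicators [c] of
    unions of components of the graph induced on [S], that is by the
    homomorphisms [x |-> (r_x, r_x c_x)] to the two-dimensional Lie algebra with
    bracket [[(u, p), (v, q)] = (0, v p - u q)]. Twins lie in the same component,
    so these factor through [M(H)]. Taking for the [r_x] powers of one scalar
    [t] whose exponents separate multidegrees, the image of a nonzero element
    is a nonzero polynomial in [t], and an infinite domain has a point where
    finitely many such polynomials do not vanish. *)

Require Import Defs.
From HB Require Import structures.
From mathcomp Require Import all_boot all_algebra.
From mathcomp Require Import boolp classical_sets.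
From mathcomp Require Import ring.

Set Implicit Arguments.
Unset Strict Implicit.
Unset Printing Implicit Defensive.

Import GRing.Theory.
Local Open Scope ring_scope.

(** * Brackets of sums and Lie homomorphisms *)

Section LieSums.
Variables (R : comNzRingType) (L : lieAlgType R).

Lemma lie0l (x : L) : lie 0 x = 0.
Proof. by apply: (addIr (lie 0 x)); rewrite -lieDl !add0r. Qed.

Lemma lie0r (x : L) : lie x 0 = 0.
Proof. by apply: (addIr (lie x 0)); rewrite -lieDr !add0r. Qed.

Lemma lie_suml (I : Type) (r : seq I) (P : pred I) (F : I -> L) y :
  lie (\sum_(i <- r | P i) F i) y = \sum_(i <- r | P i) lie (F i) y.
Proof.
by apply: (big_morph (lie^~ y)) => [u v|]; [exact: lieDl | exact: lie0l].
Qed.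

Lemma lie_sumr (I : Type) (r : seq I) (P : pred I) (F : I -> L) y :
  lie y (\sum_(i <- r | P i) F i) = \sum_(i <- r | P i) lie y (F i).
Proof.
by apply: (big_morph (lie y)) => [u v|]; [exact: lieDr | exact: lie0r].
Qed.

End LieSums.

Section LieHomTheory.
Variables (R : comNzRingType) (L L' : lieAlgType R) (h : L -> L').
Hypothesis hom_h : lie_hom h.

Lemma lie_homD x y : h (x + y) = h x + h y. Proof. by case: hom_h. Qed.
Lemma lie_homZ r x : h (r *: x) = r *: h x. Proof. by case: hom_h. Qed.
Lemma lie_homL x y : h (lie x y) = lie (h x) (h y). Proof. by case: hom_h. Qed.

Lemma lie_hom0 : h 0 = 0.
Proof. by rewrite -[X in h X](scale0r 0) lie_homZ scale0r. Qed.

Lemma lie_homN x : h (- x) = - h x.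
Proof. by rewrite -scaleN1r lie_homZ scaleN1r. Qed.

Lemma lie_homB x y : h (x - y) = h x - h y.
Proof. by rewrite lie_homD lie_homN. Qed.

Lemma lie_hom_sum (I : Type) (r : seq I) (P : pred I) (F : I -> L) :
  h (\sum_(i <- r | P i) F i) = \sum_(i <- r | P i) h (F i).
Proof. exact: (big_morph h lie_homD lie_hom0). Qed.

End LieHomTheory.

Lemma lie_hom_comp (R : comNzRingType) (L1 L2 L3 : lieAlgType R)
    (h : L1 -> L2) (h' : L2 -> L3) :
  lie_hom h -> lie_hom h' -> lie_hom (h' \o h).
Proof.
move=> [hD hZ hL] [h'D h'Z h'L].
by split=> * /=; rewrite ?hD ?hZ ?hL ?h'D ?h'Z ?h'L.
Qed.

(** * Universal sentences and discriminating homomorphisms *)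

Section UniversalTransfer.
Variables (R : comNzRingType) (L L' : lieAlgType R).

Lemma term_val_hom (h : L -> L') k (w : 'I_k -> L) (t : lie_term k) :
  lie_hom h -> term_val (h \o w) t = h (term_val w t).
Proof.
move=> hom_h; elim: t => //= [|t IHt u IHu|t IHt u IHu].
- by rewrite lie_hom0.
- by rewrite lie_homD // IHt IHu.
- by rewrite lie_homL // IHt IHu.
Qed.

Fixpoint atom_diffs k (w : 'I_k -> L) (Phi : qf_formula k) : seq L :=
  match Phi with
  | FEq t u => [:: term_val w t - term_val w u]
  | FNot P => atom_diffs w P
  | FAnd P Q | FOr P Q | FImp P Q => atom_diffs w P ++ atom_diffs w Q
  end.

(** Such an [h] identifies the two sides of an atom only if they were equal, so it preserves the
    truth value of every atom in both directions, as negation requires. *)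
Lemma sat_hom (h : L -> L') k (w : 'I_k -> L) (Phi : qf_formula k) :
  lie_hom h -> {in atom_diffs w Phi, forall u, u != 0 -> h u != 0} ->
  sat (h \o w) Phi <-> sat w Phi.
Proof.
move=> hom_h; elim: Phi => /= [t u|P IHP|P IHP Q IHQ|P IHP Q IHQ|P IHP Q IHQ] hP.
- rewrite !term_val_hom //; split=> [/eqP|-> //].
  rewrite -subr_eq0 -lie_homB // => /eqP htu; apply/eqP; rewrite -subr_eq0.
  by apply: contraPT htu => /(hP _ (mem_head _ _)) /eqP.
- by rewrite IHP.
all: have {IHP} := IHP (fun u uP => hP u (etrans (mem_cat u _ _)
       (introT orP (or_introl uP)))).
all: have {IHQ} := IHQ (fun u uQ => hP u (etrans (mem_cat u _ _)
       (introT orP (or_intror uQ)))).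
all: tauto.
Qed.

(** The homomorphism may depend on the valuation, which involves only the finitely many atoms of
    [Phi]. *)
Lemma sat_forall_discriminated :
  (forall us : seq L, {in us, forall u, u != 0} ->
     exists2 h : L -> L', lie_hom h & {in us, forall u, h u != 0}) ->
  forall k (Phi : qf_formula k), sat_forall L' Phi -> sat_forall L Phi.
Proof.
move=> disc k Phi L'Phi w.
have [|h hom_h h_n0] := disc [seq u <- atom_diffs w Phi | u != 0].
  by move=> u; rewrite mem_filter => /andP[].
have hP : {in atom_diffs w Phi, forall u, u != 0 -> h u != 0}.
  by move=> u uPhi u_n0; apply: h_n0; rewrite mem_filter u_n0.
exact: (sat_hom hom_h hP).1 (L'Phi _).
Qed.

End UniversalTransfer.

(** * Generators and universal property of [pc_metab] *)

Section PcLift.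
Variables (R : comNzRingType) (G : sgraph).

Definition pc_gen (x : G) : pc_metab R G := lie_pi _ (fm_gen R x).

Lemma pc_gen_edge (x y : G) : edge x y -> lie (pc_gen x) (pc_gen y) = 0.
Proof.
move=> xy; rewrite /pc_gen -(lie_homL (lie_pi_hom _)); apply/lie_piP.
by apply: sub_ideal_gen; exists x, y.
Qed.

Lemma pc_metab_metabelian : metabelian (pc_metab R G).
Proof.
move=> a b c d.
have [[a' <-] [b' <-]] := (lie_pi_surj a, lie_pi_surj b).
have [[c' <-] [d' <-]] := (lie_pi_surj c, lie_pi_surj d).
rewrite -!(lie_homL (lie_pi_hom _)) free_metab_metabelian.
exact: lie_hom0 (lie_pi_hom _).
Qed.

Lemma pc_metab_ind (P : pc_metab R G -> Prop) :
  (forall x, P (pc_gen x)) ->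
  (forall u v, P u -> P v -> P (u + v)) ->
  (forall r u, P u -> P (r *: u)) ->
  (forall u v, P u -> P v -> P (lie u v)) ->
  P 0 -> forall u, P u.
Proof.
move=> Pg PD PZ PL P0 u; have [{}u <-] := lie_pi_surj u.
have piH := lie_pi_hom (ideal_gen_ideal (@pc_relators R G)).
elim/free_metabW: u => t; elim: t => [x||t IH|t IHt u IHu|r t IH|t IHt u IHu].
- exact: Pg.
- by rewrite [lie_pi _ _](lie_hom0 piH).
- rewrite -pi_fq_opp -[fq_opp _]/(- _ : free_metab R G) -scaleN1r (lie_homZ piH).
  exact: PZ.
- by rewrite -pi_fq_add [lie_pi _ _](lie_homD piH); apply: PD.
- by rewrite -pi_fq_scale [lie_pi _ _](lie_homZ piH); apply: PZ.
- by rewrite -pi_fq_lie [lie_pi _ _](lie_homL piH); apply: PL.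
Qed.

Variables (L : lieAlgType R) (g : G -> L).
Hypothesis mL : metabelian L.
Hypothesis g_edge : forall x y, edge x y -> lie (g x) (g y) = 0.

Definition pc_lift (u : pc_metab R G) : L := fm_lift g (repr u).

(** The kernel of [fm_lift g] is an ideal containing the relators, so the choice of representative
    does not matter. *)
Lemma pc_lift_pi (z : free_metab R G) :
  pc_lift (lie_pi _ z) = fm_lift g z.
Proof.
have hL := fm_lift_hom g mL.
have [y Iy] := repr_lie_quot (ideal_gen_ideal (@pc_relators R G)) z.
rewrite /pc_lift /lie_pi => ->; rewrite (lie_homD hL).
suff -> : fm_lift g y = 0 by rewrite addr0.
apply: (Iy (fun y => fm_lift g y = 0)) => [|_ [x [x' [xx' ->]]]]; last first.
  by rewrite (lie_homL hL) !fm_lift_gen ?g_edge.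
split=> [|u v u0 v0|r u u0|u v v0].
- exact: lie_hom0 hL.
- by rewrite (lie_homD hL) u0 v0 addr0.
- by rewrite (lie_homZ hL) u0 scaler0.
- by rewrite (lie_homL hL) v0 lie0r.
Qed.

Lemma pc_lift_hom : lie_hom pc_lift.
Proof.
have hL := fm_lift_hom g mL.
have piH := lie_pi_hom (ideal_gen_ideal (@pc_relators R G)).
split=> [x y|r x|x y]; have [{}x <-] := lie_pi_surj x.
- have [{}y <-] := lie_pi_surj y.
  by rewrite -(lie_homD piH) !pc_lift_pi (lie_homD hL).
- by rewrite -(lie_homZ piH) !pc_lift_pi (lie_homZ hL).
- have [{}y <-] := lie_pi_surj y.
  by rewrite -(lie_homL piH) !pc_lift_pi (lie_homL hL).
Qed.

Lemma pc_lift_gen x : pc_lift (pc_gen x) = g x.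
Proof. by rewrite pc_lift_pi fm_lift_gen. Qed.

End PcLift.

(** * Left-normed brackets in a metabelian algebra *)

Lemma perm_cons2 (T : eqType) (x y : T) s : perm_eq [:: x, y & s] [:: y, x & s].
Proof. by rewrite -[_ :: _]/([:: x] ++ [:: y] ++ s) perm_catCA. Qed.

Section LeftNormedBrackets.
Variables (R : comNzRingType) (L : lieAlgType R) (X : eqType) (g : X -> L).
Hypothesis mL : metabelian L.

(** By Jacobi the two sides differ, up to sign, by the bracket of [lie a b] and [lie y z], which
    vanishes. *)
Lemma lie_swap (a b y z : L) :
  lie (lie (lie a b) y) z = lie (lie (lie a b) z) y.
Proof.
have := lie_jacobi (lie a b) y z; rewrite mL add0r.
rewrite [lie y (lie z _)]lieC [lie z (lie a b)]lieC lieNl opprK.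
by rewrite [lie z _]lieC => /eqP; rewrite subr_eq0 => /eqP.
Qed.

(** The head of [s] is bracketed last; [lnb_perm] makes the order of [s] immaterial. *)
Definition lnb (x y : X) (s : seq X) : L :=
  foldr (fun z m => lie m (g z)) (lie (g x) (g y)) s.

Lemma lnb_bracket x y s : exists a b, lnb x y s = lie a b.
Proof. by case: s => [|z s] /=; do 2!eexists. Qed.

Lemma lnb_cat_cons x y s1 z s2 :
  lnb x y (s1 ++ z :: s2) = lnb x y (z :: s1 ++ s2).
Proof.
elim: s1 => //= u s1 ->; rewrite /=.
by have [a [b ->]] := lnb_bracket x y (s1 ++ s2); rewrite lie_swap.
Qed.

Lemma lnb_perm x y s s' : perm_eq s s' -> lnb x y s = lnb x y s'.
Proof.
elim: s s' => [|z s IH] s'; first by rewrite perm_sym => /perm_nilP ->.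
move=> ss'; have zs' : z \in s' by rewrite -(perm_mem ss') mem_head.
case/splitPr: zs' ss' => s1 s2 ss'.
rewrite lnb_cat_cons /= (IH (s1 ++ s2)) // -(perm_cons z) (perm_trans ss') //.
by rewrite (perm_catCA s1 [:: z]).
Qed.

Lemma lnbC x y s : lnb x y s = - lnb y x s.
Proof.
elim: s => [|z s IH] /=; first exact: lieC.
by rewrite IH lieNl.
Qed.

Lemma lnb0 x y s : lie (g x) (g y) = 0 -> lnb x y s = 0.
Proof. by move=> xy; elim: s => [|z s /= ->] //=; rewrite lie0l. Qed.

Lemma lnb_jacobi x y z s :
  lnb x y (z :: s) = lnb x z (y :: s) - lnb y z (x :: s).
Proof.
rewrite -[z :: s]/([::] ++ z :: s) -[y :: s]/([::] ++ y :: s).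
rewrite -[x :: s]/([::] ++ x :: s).
(* Moving the third letter to the innermost place reduces the claim to Jacobi on three
   generators. *)
have push t x' y' : lnb x' y' (t :: s) = lnb x' y' (rcons s t).
  by apply: lnb_perm; rewrite perm_sym perm_rcons.
rewrite !cat0s !push /lnb !foldr_rcons.
have -> : lie (lie (g x) (g y)) (g z) =
          lie (lie (g x) (g z)) (g y) - lie (lie (g y) (g z)) (g x).
  have := lie_jacobi (g x) (g y) (g z).
  rewrite [lie (g x) (lie _ _)]lieC [lie (g y) (lie _ _)]lieC.
  rewrite [lie (g z) (lie _ _)]lieC [lie (g z) (g x)]lieC lieNl opprK.
  by move=> /eqP; rewrite subr_eq0 => /eqP <-; rewrite addrC.
elim: s {push} => //= t s ->.
by rewrite lieDl lieNl.
Qed.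

(* In [pc_metab R G], the part of multidegree [x0 :: t] is spanned by the
   differences [lnb_pot x - lnb_pot y] with [x] and [y] in [x0 :: t]. *)
Definition lnb_pot (x0 : X) (t : seq X) (x : X) : L := lnb x x0 (rem x t).

(** If [x] or [y] is [x0], its potential vanishes. Otherwise [x0] lies in [s], and [lnb_jacobi]
    brings it into the inner bracket. *)
Lemma lnb_potE x0 t x y s : perm_eq (x :: y :: s) (x0 :: t) ->
  lnb x y s = lnb_pot x0 t x - lnb_pot x0 t y.
Proof.
have pot0 : lnb_pot x0 t x0 = 0 by apply: lnb0; exact: liexx.
have [->|xy] := eqVneq x y; first by rewrite subrr lnb0 ?liexx.
have rem_perm u l : perm_eq (x0 :: u :: l) (x0 :: t) -> perm_eq l (rem u t).
  rewrite perm_cons => ult; rewrite -(perm_cons u) (perm_trans ult) //.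
  by rewrite perm_to_rem // -(perm_mem ult) mem_head.
have [->|xx0] := eqVneq x x0; have [->|yx0] := eqVneq y x0.
- by rewrite subrr lnb0 ?liexx.
- by move=> p; rewrite pot0 sub0r lnbC; congr (- _); apply/lnb_perm/rem_perm.
- move=> p; rewrite pot0 subr0; apply/lnb_perm/rem_perm/perm_trans/p.
  exact: perm_cons2.
move=> p; have x0s : x0 \in s.
  have : x0 \in x :: y :: s by rewrite (perm_mem p) mem_head.
  by rewrite !inE 2!(eq_sym x0) (negPf xx0) (negPf yx0).
have ps := perm_to_rem x0s; rewrite (lnb_perm _ _ ps) lnb_jacobi.
have p' : perm_eq (x0 :: x :: y :: rem x0 s) (x0 :: t).
  apply: perm_trans p; apply: perm_trans (perm_cons2 _ _ _) _.
  rewrite perm_cons; apply: perm_trans (perm_cons2 _ _ _) _.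
  by rewrite perm_cons perm_sym.
congr (_ - _); apply/lnb_perm/rem_perm => //.
by apply: perm_trans p'; rewrite perm_cons perm_cons2.
Qed.

(** The difference of the potentials is a bracket starting with [x] and [y], hence zero. *)
Lemma lnb_pot_edge x0 t x y : x \in x0 :: t -> y \in x0 :: t ->
  lie (g x) (g y) = 0 -> lnb_pot x0 t x = lnb_pot x0 t y.
Proof.
have [-> //|xy] := eqVneq x y => xt yt gxy.
have yt' : y \in rem x (x0 :: t).
  have := yt; rewrite (perm_mem (perm_to_rem xt)) inE eq_sym (negPf xy).
  by [].
have p : perm_eq (x :: y :: rem y (rem x (x0 :: t))) (x0 :: t).
  rewrite perm_sym (perm_trans (perm_to_rem xt)) // perm_cons.
  exact: perm_to_rem.
by apply/eqP; rewrite -subr_eq0 -(lnb_potE p) lnb0.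
Qed.

End LeftNormedBrackets.

(** * Detection by connected components *)

(* A combination of differences [v x - v y] of a function [v] constant on the
   connected components of [e] is detected by the indicators of components. *)
Lemma component_indicator (R : pzRingType) (V : lmodType R) (T : finType)
    (e : rel T) (v : T -> V) (I : Type) (r : seq I) (P : pred I)
    (b : I -> R) (x y : I -> T) :
  symmetric e -> (forall z z', e z z' -> v z = v z') ->
  (forall c : T -> bool, (forall z z', e z z' -> c z = c z') ->
    \sum_(i <- r | P i) b i * ((c (x i))%:R - (c (y i))%:R) = 0) ->
  \sum_(i <- r | P i) b i *: (v (x i) - v (y i)) = 0.
Proof.
move=> e_sym v_e cP.
have ec : connect_sym e by apply: sym_connect_sym.
(* The coefficient of [v t] is the indicator of the component with root [t], which is the [c] used
   below. *)
have v_root z : v z = \sum_t (fingraph.root e z == t)%:R *: v t.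
  rewrite (bigD1 (fingraph.root e z)) //= eqxx scale1r big1 ?addr0 => [|t].
    have /connectP[p] := connect_root e z; move: (fingraph.root e z) => z'.
    elim: p z => /= [z _ -> //|t p IH z /andP[zt tp] z'E].
    by rewrite (v_e _ _ zt) (IH t).
  by rewrite eq_sym => /negPf ->; rewrite scale0r.
under eq_bigr => i _ do rewrite (v_root (x i)) (v_root (y i)) -sumrB scaler_sumr.
rewrite exchange_big big1 //= => t _.
under eq_bigr => i _ do rewrite -scalerBl scalerA.
rewrite -scaler_suml (cP (fun z => fingraph.root e z == t)) ?scale0r // => z z' zz'.
by congr (_ == _); apply/(fingraph.rootP ec)/connect1.
Qed.

(** * Encoding multidegrees in base [K] *)

Section KroneckerWeight.
Variables (T : finType) (K : nat).

(** Kronecker substitution: the base [K] digits are the multiplicities in [s], without carries when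
    [size s < K]. *)
Definition kwt (s : seq T) : nat := \sum_(z <- s) K ^ enum_rank z.

Lemma base_expansion_inj n (a b : nat -> nat) :
  (forall i, a i < K)%N -> (forall i, b i < K)%N ->
  (\sum_(i < n) a i * K ^ i = \sum_(i < n) b i * K ^ i)%N ->
  forall i, (i < n)%N -> a i = b i.
Proof.
elim: n a b => // n IH a b aK bK; rewrite !big_ord_recl /= !muln1.
have shift (d : nat -> nat) : (\sum_(i < n) d (bump 0 i) * K ^ bump 0 i =
    (\sum_(i < n) d i.+1 * K ^ i) * K)%N.
  by rewrite big_distrl; apply: eq_bigr => i _; rewrite expnSr mulnA.
rewrite !shift => abE.
have ab0 : a 0%N = b 0%N.
  have := congr1 (modn^~ K) abE.
  by rewrite !(addnC (_ 0%N)) !modnMDl !modn_small.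
have K_gt0 : (0 < K)%N by apply: leq_ltn_trans (aK 0%N).
move: abE; rewrite ab0 => /addnI/eqP; rewrite eqn_pmul2r // => /eqP abE.
case=> // i; rewrite ltnS => lin.
exact: (IH (fun i => a i.+1) (fun i => b i.+1)).
Qed.

Lemma kwt_perm s s' : (size s < K)%N -> (size s' < K)%N ->
  kwt s = kwt s' -> perm_eq s s'.
Proof.
have kwtE (l : seq T) :
    kwt l = (\sum_(i < #|T|) count_mem (enum_val i) l * K ^ i)%N.
  rewrite /kwt; elim: l => [|z l IH]; first by rewrite big_nil big1.
  rewrite big_cons IH (bigD1 (enum_rank z)) //= [RHS](bigD1 (enum_rank z)) //=.
  rewrite enum_rankK eqxx mulnDl mul1n addnA; congr (_ + _)%N.
  apply: eq_bigr => i iz; rewrite -[z]enum_rankK (inj_eq enum_val_inj).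
  by rewrite eq_sym (negPf iz).
move=> sK s'K; rewrite !kwtE => E.
apply/allP => x _ /=; apply/eqP.
(* Past the end of the enumeration [nth] returns [x], so the digits stay below [K] at every
   index. *)
pose cnt (l : seq T) i := count_mem (nth x (enum T) i) l.
have cntK l i : (size l < K)%N -> (cnt l i < K)%N.
  exact/leq_ltn_trans/count_size.
have := @base_expansion_inj #|T| (cnt s) (cnt s') (fun i => cntK s i sK)
  (fun i => cntK s' i s'K) _ (enum_rank x) (ltn_ord _).
have cntE l (i : 'I_#|T|) : cnt l i = count_mem (enum_val i) l.
  by rewrite /cnt (enum_val_nth x).
under eq_bigr do rewrite cntE.
under [in X in _ = X -> _]eq_bigr do rewrite cntE.
by rewrite !cntE enum_rankK; apply.
Qed.

End KroneckerWeight.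

(** * A spanning family of [pc_metab] *)

Section Span.
Variables (R : comNzRingType) (G : sgraph).
Local Notation M := (pc_metab R G).
Local Notation pcg := (@pc_gen R G).

Definition lin_part (a : G -> R) : M := \sum_x a x *: pcg x.
Definition der_part (ts : seq (R * (G * G * seq G))) : M :=
  \sum_(k <- ts) k.1 *: lnb pcg k.2.1.1 k.2.1.2 k.2.2.

Lemma lin_part0 a : (forall x, a x = 0) -> lin_part a = 0.
Proof. by move=> a0; rewrite /lin_part big1 // => x _; rewrite a0 scale0r. Qed.

Definition in_der (u : M) : Prop := exists ts, u = der_part ts.

Lemma in_der0 : in_der 0.
Proof. by exists [::]; rewrite /der_part big_nil. Qed.

Lemma in_derD u v : in_der u -> in_der v -> in_der (u + v).
Proof.
by move=> [ts ->] [ts' ->]; exists (ts ++ ts'); rewrite /der_part big_cat.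
Qed.

Lemma in_derZ r u : in_der u -> in_der (r *: u).
Proof.
move=> [ts ->]; exists [seq (r * k.1, k.2) | k <- ts].
rewrite /der_part big_map scaler_sumr.
by under [RHS]eq_bigr do rewrite -scalerA.
Qed.

Lemma in_der_sum (I : finType) (F : I -> M) :
  (forall i, in_der (F i)) -> in_der (\sum_i F i).
Proof.
by move=> FP; apply: big_ind => //; [exact: in_der0 | exact: in_derD].
Qed.

Lemma in_der_lie_lin u a : in_der u -> in_der (lie u (lin_part a)).
Proof.
move=> [ts ->]; rewrite /lin_part lie_sumr; apply: in_der_sum => x.
rewrite lieZr; apply: in_derZ.
exists [seq (k.1, (k.2.1, x :: k.2.2)) | k <- ts].
rewrite /der_part big_map lie_suml; apply: eq_bigr => k _.
by rewrite lieZl.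
Qed.

(** In a bracket of two such sums, the linear parts give brackets of generators, the mixed terms
    lengthen left-normed brackets, and the two derived parts commute. No uniqueness is claimed. *)
Lemma pc_metab_span u : exists a ts, u = lin_part a + der_part ts.
Proof.
suff [a [_ [ts ->] ->]] : exists a, exists2 v, in_der v & u = lin_part a + v.
  by exists a, ts.
elim/pc_metab_ind: u => [x|u v [a [u' du ->]] [b [v' dv ->]]|
    r u [a [u' du ->]]|u v [a [u' [ts ->] ->]] [b [v' [ts' ->] ->]]|].
- exists (fun y => (y == x)%:R), 0; first exact: in_der0.
  rewrite addr0 /lin_part (bigD1 x) //= eqxx scale1r big1 ?addr0 // => y.
  by move=> /negPf ->; rewrite scale0r.
- exists (fun x => a x + b x), (u' + v'); first exact: in_derD.
  rewrite addrACA; congr (_ + _); rewrite /lin_part -big_split.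
  by apply: eq_bigr => x _; rewrite scalerDl.
- exists (fun x => r * a x), (r *: u'); first exact: in_derZ.
  rewrite scalerDr; congr (_ + _); rewrite /lin_part scaler_sumr.
  by apply: eq_bigr => x _; rewrite scalerA.
- exists (fun=> 0), (lie (lin_part a + der_part ts) (lin_part b + der_part ts'));
    last by rewrite (@lin_part0 (fun=> 0)) ?add0r.
  have dts : in_der (der_part ts) by exists ts.
  have dts' : in_der (der_part ts') by exists ts'.
  rewrite lieDr !lieDl.
  have -> : lie (der_part ts) (der_part ts') = 0.
    rewrite /der_part lie_suml big1 // => k _.
    rewrite lie_sumr big1 // => k' _; rewrite lieZl lieZr.
    have [x [y ->]] := lnb_bracket pcg k.2.1.1 k.2.1.2 k.2.2.
    have [x' [y' ->]] := lnb_bracket pcg k'.2.1.1 k'.2.1.2 k'.2.2.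
    by rewrite pc_metab_metabelian !scaler0.
  rewrite addr0; apply: in_derD; first apply: in_derD.
  + rewrite {1}/lin_part lie_suml; apply: in_der_sum => x.
    rewrite /lin_part lie_sumr; apply: in_der_sum => y.
    rewrite lieZl lieZr; do 2!apply: in_derZ.
    by exists [:: (1, (x, y, [::]))]; rewrite /der_part big_seq1 scale1r.
  + exact: in_der_lie_lin.
  + by rewrite lieC -scaleN1r; apply/in_derZ/in_der_lie_lin.
- exists (fun=> 0), 0; first exact: in_der0.
  by rewrite addr0 lin_part0.
Qed.

End Span.

(** * The test algebra *)

(* The two-dimensional non-abelian Lie algebra: [(u, p)] acts on the abelian
   ideal [{0} x R] as multiplication by the scalar [u], up to sign. *)
Definition aff (R : comNzRingType) := (R^o * R^o)%type.

Section Aff.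
Variable R : comNzRingType.
HB.instance Definition _ := GRing.Lmodule.on (aff R).
Implicit Types x y z : aff R.

Definition aff_lie x y : aff R := (0, y.1 * x.2 - x.1 * y.2).

Lemma aff_lieDl x y z : aff_lie (x + y) z = aff_lie x z + aff_lie y z.
Proof. by congr pair => /=; [rewrite addr0 | ring]. Qed.
Lemma aff_lieDr x y z : aff_lie x (y + z) = aff_lie x y + aff_lie x z.
Proof. by congr pair => /=; [rewrite addr0 | ring]. Qed.
Lemma aff_lieZl r x y : aff_lie (r *: x) y = r *: aff_lie x y.
Proof.
congr pair => /=; first by rewrite scaler0.
by rewrite -![_ *: _]/(_ * _); ring.
Qed.
Lemma aff_lieZr r x y : aff_lie x (r *: y) = r *: aff_lie x y.
Proof.
congr pair => /=; first by rewrite scaler0.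
by rewrite -![_ *: _]/(_ * _); ring.
Qed.
Lemma aff_liexx x : aff_lie x x = 0.
Proof. by congr pair => /=; ring. Qed.
Lemma aff_jacobi x y z :
  aff_lie x (aff_lie y z) + aff_lie y (aff_lie z x) + aff_lie z (aff_lie x y)
  = 0.
Proof. by congr pair => /=; [rewrite !addr0 | ring]. Qed.
HB.instance Definition _ := Lmodule_hasLie.Build R (aff R)
  aff_lieDl aff_lieDr aff_lieZl aff_lieZr aff_liexx aff_jacobi.

Lemma aff_metabelian : metabelian (aff R).
Proof. by move=> a b c d; congr pair => /=; ring. Qed.

End Aff.

Section AffTheory.
Variable R : comNzRingType.

(** Each further letter [z] multiplies the second coordinate by [p z]: the product records the
    multidegree, and [c x - c y] mirrors the difference of potentials in [lnb_potE]. *)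
Lemma lnb_aff (X : eqType) (p c : X -> R) (x y : X) (s : seq X) :
  lnb (fun z => (p z, p z * c z) : aff R) x y s =
  (0, (\prod_(z <- [:: x, y & s]) p z) * (c x - c y)).
Proof.
elim: s => [|z s /= ->].
  by rewrite !big_cons big_nil; congr pair => /=; ring.
by rewrite !big_cons; congr pair => /=; ring.
Qed.

Lemma aff_sum1 (I : Type) (r : seq I) (F : I -> aff R) :
  (\sum_(i <- r) F i).1 = \sum_(i <- r) (F i).1.
Proof. exact: (big_morph fst). Qed.

Lemma aff_sum2 (I : Type) (r : seq I) (F : I -> aff R) :
  (\sum_(i <- r) F i).2 = \sum_(i <- r) (F i).2.
Proof. exact: (big_morph snd). Qed.

End AffTheory.

Lemma lie_hom_lnb (R : comNzRingType) (L L' : lieAlgType R) (h : L -> L')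
    (X : eqType) (g : X -> L) x y s :
  lie_hom h -> h (lnb g x y s) = lnb (h \o g) x y s.
Proof.
by move=> hom_h; elim: s => [|z s IH] /=; rewrite (lie_homL hom_h) ?IH.
Qed.

(** * Nonroots of polynomials and sums over fibres *)

Lemma poly_nonroot (R : idomainType) (P : {poly R}) :
  injective (fun n : nat => n%:R : R) -> P != 0 -> exists t, P.[t] != 0.
Proof.
move=> natI P0; apply: contrapT => noroot.
(* A nonzero [P] has fewer than [size P] roots, so these [size P] distinct scalars cannot all be
   roots. *)
have := @max_poly_roots _ P [seq n%:R | n <- iota 0 (size P)] P0.
rewrite map_inj_uniq // iota_uniq size_map size_iota ltnn => bad.
suff // : false by [].
apply: bad => //; apply/allP => t _; rewrite /root.
by apply/negP => /negP tP; apply: noroot; exists t.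
Qed.

Lemma sum_fibers0 (V : nmodType) (I : Type) (r : seq I) (F : I -> V)
    (d : I -> nat) :
  (forall n, \sum_(k <- r | d k == n) F k = 0) -> \sum_(k <- r) F k = 0.
Proof.
move=> Fn; have [B dB] : exists B, all (fun k => (d k < B)%N) r.
  elim: r {Fn} => [|k r [B rB]]; first by exists 0%N.
  exists (maxn (d k).+1 B); rewrite /= leq_maxl /=.
  by apply: sub_all rB => j jB; rewrite (leq_trans jB) ?leq_maxr.
have -> : \sum_(k <- r) F k = \sum_(k <- r) \sum_(n < B | d k == n) F k.
  elim: r dB {Fn} => [|k r IH] /=; first by rewrite !big_nil.
  by move=> /andP[kB rB]; rewrite !big_cons -IH // (big_pred1 (Ordinal kB)).
rewrite (exchange_big_dep xpredT) //= big1 // => n _; exact: Fn.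
Qed.

(** * Collapsing classes of twins *)

Section TwinCollapse.
Variables (R : idomainType) (G H : sgraph) (f : G -> H).
(* The fibres of [f] are classes of adjacent vertices with equal closed
   neighbourhoods, and [H] is the corresponding quotient graph. *)
Hypothesis f_twin : forall x x' : G,
  (x == x') || edge x x' = (f x == f x') || edge (f x) (f x').

Lemma f_edge (x x' : G) : edge x x' -> f x = f x' \/ edge (f x) (f x').
Proof.
move=> xx'; have := f_twin x x'; rewrite xx' orbT => /esym/orP[/eqP|].
  by left.
by right.
Qed.

(* The exponents [K ^ i] separate multidegrees with entries below [K], so that
   the coefficients of the powers of [t] in an image are the homogeneous
   components of the argument. *)
Definition theta K (t : R) : pc_metab R G -> pc_metab R H :=
  pc_lift (fun x => t ^+ (K ^ enum_rank x) *: pc_gen R (f x)).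

Lemma theta_edge K t (x x' : G) : edge x x' ->
  lie (t ^+ (K ^ enum_rank x) *: pc_gen R (f x))
      (t ^+ (K ^ enum_rank x') *: pc_gen R (f x')) = 0.
Proof.
move=> /f_edge[ff|ff]; rewrite lieZl lieZr; first by rewrite ff liexx !scaler0.
by rewrite pc_gen_edge // !scaler0.
Qed.

Lemma theta_hom K t : lie_hom (theta K t).
Proof. by apply: pc_lift_hom; [exact: pc_metab_metabelian|exact: theta_edge]. Qed.

Lemma theta_gen K t x :
  theta K t (pc_gen R x) = t ^+ (K ^ enum_rank x) *: pc_gen R (f x).
Proof. by apply: pc_lift_gen; [exact: pc_metab_metabelian|exact: theta_edge]. Qed.

(* On multidegree [s] supported in the preimage of [S], [chi S c] reads
   [x - y] as [c (f x) - c (f y)]. *)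
Section Character.
Variables (S : pred H) (c : H -> bool).
Hypothesis Sc : forall y y', S y -> S y' -> edge y y' -> c y = c y'.

Definition chi : pc_metab R H -> aff R :=
  pc_lift (fun y => ((S y)%:R, (S y)%:R * (c y)%:R) : aff R).

Lemma chi_edge (y y' : H) : edge y y' ->
  lie (((S y)%:R, (S y)%:R * (c y)%:R) : aff R)
      (((S y')%:R, (S y')%:R * (c y')%:R) : aff R) = 0.
Proof.
move=> yy'; congr pair => /=; have := @Sc y y'.
case: (S y) => [|_]; last by rewrite /=; ring.
case: (S y') => [Scy|_]; last by rewrite /=; ring.
by rewrite (Scy isT isT yy') /=; ring.
Qed.

Lemma chi_hom : lie_hom chi.
Proof. by apply: pc_lift_hom; [exact: aff_metabelian|exact: chi_edge]. Qed.

Lemma chi_gen y : chi (pc_gen R y) = ((S y)%:R, (S y)%:R * (c y)%:R).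
Proof. by apply: pc_lift_gen; [exact: aff_metabelian|exact: chi_edge]. Qed.

Variables (K : nat) (t : R).
Let p x : R := t ^+ (K ^ enum_rank x) * (S (f x))%:R.

Lemma chi_theta_gen x : chi (theta K t (pc_gen R x)) = (p x, p x * (c (f x))%:R).
Proof.
rewrite theta_gen (lie_homZ chi_hom) chi_gen.
by congr pair; rewrite -[LHS]/(_ * _) /p // mulrA.
Qed.

Lemma chi_theta_lin a :
  (chi (theta K t (lin_part a))).1 = \sum_x a x * p x.
Proof.
have hom := lie_hom_comp (theta_hom K t) chi_hom.
rewrite -[chi _]/((chi \o theta K t) _) /lin_part (lie_hom_sum hom) aff_sum1.
by apply: eq_bigr => x _; rewrite (lie_homZ hom) /= chi_theta_gen.
Qed.

Lemma chi_theta_der ts :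
  (chi (theta K t (der_part ts))) =
  (0, \sum_(k <- ts) k.1 * (\prod_(z <- [:: k.2.1.1, k.2.1.2 & k.2.2]) p z *
       ((c (f k.2.1.1))%:R - (c (f k.2.1.2))%:R))).
Proof.
have hom := lie_hom_comp (theta_hom K t) chi_hom.
have genE : (chi \o theta K t) \o @pc_gen R G =
    fun z => (p z, p z * (c (f z))%:R) : aff R.
  by apply/funext => z /=; rewrite chi_theta_gen.
rewrite -[chi _]/((chi \o theta K t) _) /der_part (lie_hom_sum hom).
have E k : (chi \o theta K t) (k.1 *: lnb (@pc_gen R G) k.2.1.1 k.2.1.2 k.2.2) =
  (0, k.1 * (\prod_(z <- [:: k.2.1.1, k.2.1.2 & k.2.2]) p z *
       ((c (f k.2.1.1))%:R - (c (f k.2.1.2))%:R))) :> aff R.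
  rewrite (lie_homZ hom) (lie_hom_lnb _ _ _ _ hom) genE.
  rewrite (lnb_aff p (fun z => (c (f z))%:R)).
  by congr pair; rewrite -[LHS]/(_ * _) // mulr0.
rewrite [LHS]surjective_pairing aff_sum1 aff_sum2; congr pair.
  by rewrite big1 // => k _; rewrite E.
by apply: eq_bigr => k _; rewrite E.
Qed.

Lemma prod_p s :
  \prod_(z <- s) p z = t ^+ kwt K s * \prod_(z <- s) (S (f z))%:R.
Proof. by rewrite big_split /= /kwt (big_morph _ (exprD t) (expr0 t)). Qed.

End Character.

Lemma theta_separates u : u != 0 ->
  exists K0, forall K, (K0 <= K)%N ->
  exists2 P : {poly R}, P != 0 & forall t, P.[t] != 0 -> theta K t u != 0.
Proof.
have [a [ts ->]] := pc_metab_span u.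
have [[x0 ax0] _|/forallNP a0] := pselect (exists x, a x != 0).
  (* From [K = 2] on, one-letter words have length below [K], so distinct vertices have distinct
     exponents. *)
  exists 2%N => K K2; pose P := \sum_x a x *: 'X^(K ^ enum_rank x).
  exists P => [|t].
    apply: contraNneq ax0 => P0; have := congr1 (coefp (K ^ enum_rank x0)) P0.
    rewrite /= coef_sum coef0 (bigD1 x0) //= big1 => [|x xx0].
      by rewrite coefZ coefXn eqxx mulr1 addr0 => ->.
    rewrite coefZ coefXn; case: eqP => [E|_]; last by rewrite mulr0.
    have /perm_mem/(_ x) : perm_eq [:: x0] [:: x].
      by apply: (@kwt_perm _ K); rewrite // /kwt !big_seq1.
    by rewrite !inE (negPf xx0) eqxx.
  apply: contraNneq => u0.
  (* With every vertex kept and [c] zero, the first coordinate of [chi] reads the linear part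
     alone. *)
  have Sc (y y' : H) : predT y -> predT y' -> edge y y' -> false = false by [].
  have := congr1 fst (congr1 (chi predT xpred0) u0).
  rewrite (lie_hom0 (chi_hom Sc)) (lie_homD (theta_hom K t)).
  rewrite (lie_homD (chi_hom Sc)) /= chi_theta_lin // chi_theta_der //= addr0.
  rewrite /P horner_sum => {2}<-; apply/eqP/eq_bigr => x _.
  by rewrite hornerZ hornerXn mulr1.
rewrite lin_part0 ?add0r => [|x]; last by apply/eqP/negPn/negP/a0.
pose l (k : R * (G * G * seq G)) := [:: k.2.1.1, k.2.1.2 & k.2.2].
(* Once [K] exceeds the length of every bracket in [ts], equal weights mean equal multidegrees. *)
move=> u0; exists (\max_(k <- ts) size (l k)).+1 => K maxK.
have lK k : k \in ts -> (size (l k) < K)%N.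
  move=> kts; apply: leq_trans maxK; rewrite ltnS.
  exact: (leq_bigmax_seq _ (F := fun k => size (l k))) kts _.
pose F k : pc_metab R G := k.1 *: lnb (@pc_gen R G) k.2.1.1 k.2.1.2 k.2.2.
have [n un0] : exists n, \sum_(k <- ts | kwt K (l k) == n) F k <> 0.
  apply/not_existsP => Fn; move/eqP: u0; apply.
  apply: (@sum_fibers0 _ _ ts F (fun k => kwt K (l k))) => n.
  by apply: contrapT; apply: (Fn n).
have [k0 k0ts /eqP k0n] : exists2 k0, k0 \in ts & kwt K (l k0) == n.
  apply/hasP; apply: contrapT => /negP nhas; apply: un0.
  exact: big_hasC nhas.
set r := [seq k <- ts | kwt K (l k) == n].
have r_perm k : k \in r -> perm_eq (l k) (l k0).
  rewrite mem_filter => /andP[/eqP kn kts].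
  by apply: (@kwt_perm _ K); rewrite ?lK // kn k0n.
(* All terms of weight [n] share the multidegree of [k0], so one potential serves them all. *)
pose E := lnb_pot (@pc_gen R G) k0.2.1.1 (k0.2.1.2 :: k0.2.2).
have rE k : k \in r -> F k = k.1 *: (E k.2.1.1 - E k.2.1.2).
  move=> /r_perm rk; congr (_ *: _); apply: lnb_potE rk.
  exact: pc_metab_metabelian.
pose e (x x' : G) := [&& x \in l k0, x' \in l k0 & edge x x'].
(* If no polynomial works, every component indicator on the support of [k0] gives zero, so the
   component of weight [n] vanishes. *)
apply: contrapT => noP; apply: un0; rewrite -big_filter -/r.
rewrite (eq_big_seq _ rE); apply: (@component_indicator _ _ _ e).
- by move=> x x'; rewrite /e andbCA edge_sym.
- move=> x x' /and3P[xl x'l xx']; apply: lnb_pot_edge => //.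
    exact: pc_metab_metabelian.
  exact: pc_gen_edge.
move=> c ce; apply/eqP/contraT => sum_n0; exfalso; apply: noP.
pose S := [pred y | y \in [seq f x | x <- l k0]].
(* [c] descends along [f] because vertices of the support with the same image are equal or adjacent.
   The default [false] is taken only where [S] fails. *)
pose c' y := if [pick x | (x \in l k0) && (f x == y)] is Some x then c x
             else false.
have c'f x : x \in l k0 -> c' (f x) = c x.
  rewrite /c'; case: pickP => [x' /andP[x'l ff] xl|/(_ x)]; last first.
    by rewrite eqxx andbT => ->.
  have := f_twin x' x; rewrite ff => /orP[/eqP -> //|xx'].
  by apply: ce; rewrite /e x'l xl.
have Sc y y' : S y -> S y' -> edge y y' -> c' y = c' y'.
  move=> /mapP[x xl ->] /mapP[x' x'l ->] ff; rewrite !c'f //.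
  have := f_twin x x'; rewrite ff orbT => /orP[/eqP -> //|xx'].
  by apply: ce; rewrite /e x'l xl.
pose d (k : R * (G * G * seq G)) : R := (c' (f k.2.1.1))%:R - (c' (f k.2.1.2))%:R.
(* This is the second coordinate of the image under [chi] as a polynomial in [t]; its coefficient at
   [n] is the nonzero sum given by [c]. *)
pose P : {poly R} := \sum_(k <- ts)
  (k.1 * (\prod_(z <- l k) (S (f z))%:R * d k)) *: 'X^(kwt K (l k)).
exists P => [|t].
  apply: contraNneq sum_n0 => P0; have := congr1 (coefp n) P0.
  rewrite /= coef_sum coef0 => {2}<-; apply/eqP.
  rewrite big_filter big_mkcond big_seq [RHS]big_seq; apply: eq_bigr => k kts.
  rewrite coefZ coefXn eq_sym; case: eqP => [kn|_]; last by rewrite mulr0.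
  have pk : perm_eq (l k) (l k0) by apply: r_perm; rewrite mem_filter kn eqxx.
  have kl z : z \in l k -> z \in l k0 by rewrite (perm_mem pk).
  rewrite mulr1 /d !c'f ?kl ?inE ?eqxx ?orbT //.
  rewrite big1_seq ?mul1r // => z /andP[_ zl].
  by rewrite /S inE map_f ?kl.
apply: contraNneq => /(congr1 (chi S c')); rewrite (lie_hom0 (chi_hom Sc)).
rewrite chi_theta_der // => /(congr1 snd) /= sum0; apply/eqP.
rewrite -[RHS]sum0 /P horner_sum; apply: eq_bigr => k _.
rewrite hornerZ hornerXn (prod_p S K t (l k)) /d; ring.
Qed.

(** The thresholds combine by their maximum, and the product of the polynomials is nonzero over a
    domain. *)
Lemma theta_separates_seq (us : seq (pc_metab R G)) : {in us, forall u, u != 0} ->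
  exists K0, forall K, (K0 <= K)%N ->
  exists2 P : {poly R}, P != 0 &
    forall t, P.[t] != 0 -> {in us, forall u, theta K t u != 0}.
Proof.
elim: us => [|u us IH] us0; first by exists 0%N => K _; exists 1; rewrite ?oner_eq0.
have [K1 KP1] := theta_separates (us0 u (mem_head _ _)).
have [|K2 KP2] := IH; first by move=> v vus; apply: us0; rewrite inE vus orbT.
exists (maxn K1 K2) => K; rewrite geq_max => /andP[/KP1[P1 P1_n0 P1u] /KP2].
move=> [P2 P2_n0 P2us]; exists (P1 * P2); first by rewrite mulf_neq0.
move=> t; rewrite hornerM mulf_eq0 negb_or => /andP[/P1u ut /P2us ust] v.
by rewrite inE => /orP[/eqP->|/ust].
Qed.

Theorem twin_collapse_equivalent (g : H -> G) :
  injective (fun n : nat => n%:R : R) -> cancel g f ->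
  universally_equivalent (pc_metab R G) (pc_metab R H).
Proof.
move=> natI gK k Phi; split; apply: sat_forall_discriminated => us us0.
  have g_edge (y y' : H) : edge y y' -> lie (pc_gen R (g y)) (pc_gen R (g y')) = 0.
    move=> yy'; have := f_twin (g y) (g y'); rewrite !gK yy' orbT.
    by move=> /orP[/eqP->|/pc_gen_edge ->]; rewrite ?liexx.
  have mG := @pc_metab_metabelian R G.
  exists (pc_lift (fun y => pc_gen R (g y))); first exact: pc_lift_hom.
  move=> u /us0; apply: contraNneq => hu0.
  (* At [t = 1] all scaling factors are 1, so [theta 0 1] is induced by [f] alone and is a left
     inverse of the embedding. *)
  have hom := lie_hom_comp (pc_lift_hom mG g_edge) (theta_hom 0 1).
  suff <- : theta 0 1 (pc_lift (fun y => pc_gen R (g y)) u) = u.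
    by rewrite hu0 (lie_hom0 (theta_hom 0 1)).
  rewrite -[LHS]/((_ \o _) u); elim/pc_metab_ind: u {hu0}.
  - by move=> y /=; rewrite pc_lift_gen // theta_gen expr1n scale1r gK.
  - by move=> u v uE vE; rewrite (lie_homD hom) uE vE.
  - by move=> r u uE; rewrite (lie_homZ hom) uE.
  - by move=> u v uE vE; rewrite (lie_homL hom) uE vE.
  - exact: lie_hom0 hom.
have [K0 /(_ K0 (leqnn _))[P /(poly_nonroot natI)[t /[swap]]]] :=
  theta_separates_seq us0.
by move=> /[apply] tus; exists (theta K0 t) => //; exact: theta_hom.
Qed.

End TwinCollapse.

(** * The two concrete graphs *)

Lemma cycle_two_neighbours (T : eqType) (e : rel T) (p : seq T) x :
  (2 < size p)%N -> uniq p -> cycle e p -> x \in p ->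
  exists y z, [/\ y != z, e x y & e z x].
Proof.
(* With [x] rotated to the front, the second and last vertices are its neighbours, distinct because
   the length exceeds two. *)
move=> p2 up cp /rot_to[i q pq].
have {p2} : (2 < size (x :: q))%N by rewrite -pq size_rot.
have {up} : uniq (x :: q) by rewrite -pq rot_uniq.
have {cp} : cycle e (x :: q) by rewrite -pq rot_cycle.
case: q {pq} => [|y q] //=; case/lastP: q => [|q z] //=.
rewrite rcons_path last_rcons => /andP[xy /andP[_ zx]] /and3P[_ yz _] _.
exists y, z; split=> //; apply: contraNneq yz => ->.
by rewrite mem_rcons mem_head.
Qed.

(** The leaves [Ha], [Hd], [He] lie on no cycle, which leaves only two vertices for at least three
    distinct places. *)
Lemma graphGbar_tree : is_tree graphGbar.
Proof.
have Gbar_sym : connect_sym (@edge graphGbar).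
  by apply: sym_connect_sym; exact: edge_sym.
split; first by apply/card_gt0P; exists Ha.
  have cC (x : graphGbar) : connect (@edge graphGbar) Hc x.
    case: x; try exact: connect0; try exact: connect1.
    by apply: (@connect_trans _ _ Hb); exact: connect1.
  by move=> x y; apply: connect_trans (cC y); rewrite Gbar_sym.
move=> [p [p2 up cp]].
have leaf (x y : graphGbar) : (forall z, edge x z -> z = y) -> x \notin p.
  move=> xy; apply/negP => /(cycle_two_neighbours p2 up cp)[z [z' [zz' xz z'x]]].
  by move: zz'; rewrite (xy z) // (xy z') ?eqxx // edge_sym.
have pbc : {subset p <= [:: Hb; Hc]}.
  move=> x; apply: contraTT => xbc.
  by case: x xbc => // _; [apply: (leaf _ Hb)|apply: (leaf _ Hc)|
    apply: (leaf _ Hc)]; case.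
by have := uniq_leq_size up pbc; rewrite leqNgt p2.
Qed.

Definition collapse (x : graphG) : graphGbar :=
  match x with
  | Ga => Ha | Gb1 | Gb2 | Gb3 => Hb | Gc => Hc | Gd => Hd | Ge => He
  end.

Definition lift_vertex (y : graphGbar) : graphG :=
  match y with Ha => Ga | Hb => Gb1 | Hc => Gc | Hd => Gd | He => Ge end.

Theorem mainTheorem3 (R : idomainType)
    (Z_sub_R : injective (fun z : int => z%:~R : R)) :
  is_tree graphGbar /\ ~ is_tree graphG /\
  universally_equivalent (pc_metab R graphG) (pc_metab R graphGbar).
Proof.
split; first exact: graphGbar_tree.
split; first by move=> [_ _]; apply; exists [:: Gb1; Gb2; Gb3].
apply: (@twin_collapse_equivalent R graphG graphGbar collapse _ lift_vertex).
- by do 2!case.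
- by move=> m n mn; have [] := Z_sub_R m%:Z n%:Z mn.
- by case.
Qed.
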